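(* Let $q>0$, $q\neq1$, $N\in\mathbb{Z}_{\ge0}$, $s,t\in\mathbb{R}$ and $v\in\mathbb{C}$. Then for all $y,y'\in\{0,\dots,N\}$, $$\sum_{x=0}^N R_{\mathrm r}(x,y;s,t,v,N)\,\overline{R_{\mathrm r}(x,y';s,t,-\overline v-2,N)}\,W(x,s;q^{-1})=\frac{\delta_{y,y'}}{W(y,t;q^{-1})},$$ and for all $x,x'\in\{0,\dots,N\}$, $$\sum_{y=0}^N R_{\mathrm r}(x,y;s,t,v,N)\,\overline{R_{\mathrm r}(x',y;s,t,-\overline v-2,N)}\,W(y,t;q^{-1})=\frac{\delta_{x,x'}}{W(x,s;q^{-1})}.$$
   Context: $q^z=e^{z\log q}$; $(\alpha;p)_n=\prod_{i=0}^{n-1}(1-\alpha p^i)$, $(\alpha_1,\dots,\alpha_m;p)_n=\prod_i(\alpha_i;p)_n$; $\begin{bmatrix}N\\ n\end{bmatrix}_{p}=\frac{(p;p)_N}{(p;p)_n(p;p)_{N-n}}$. For $u,s\in\mathbb{C}$ and $n,x\in\{0,\dots,N\}$, $$k_{u,s}(n,x)=(-1)^nq^{n(s-u-\frac12N+\frac12)}\sum_{j=0}^{\min(n,x)}\frac{(q^{2n},\,q^{2x},\,-q^{-2x-2s+2N};q^{-2})_j}{(q^{2N},\,q^{-2};q^{-2})_j}q^{-2j},\qquad w(n)=q^{n(n-N)}\begin{bmatrix}N\\ n\end{bmatrix}_{q^2},$$ $$R_{\mathrm r}(x,y;s,t,v,N)=\sum_{n=0}^N k_{1,s}(n,x)\,k_{v,t}(n,y)\,w(n).$$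 For a base $p>0$, $p\neq1$, $$W(x,s;p)=\frac{1+p^{4x+2s-2N}}{1+p^{2s-2N}}\,\frac{(-p^{2s-2N};p^2)_x}{(-p^{2s+2};p^2)_x}\,\frac{p^{-x(2s+1+x-2N)}}{(-p^{-2s};p^2)_N}\begin{bmatrix}N\\ x\end{bmatrix}_{p^2},$$ used with $p=q^{-1}$. *)

(* Defs.v *)
From HB Require Import structures.
From mathcomp Require Import all_boot all_order all_algebra.
From mathcomp Require Import complex.
From mathcomp Require Import reals sequences exp trigo.

Set Implicit Arguments.
Unset Strict Implicit.
Unset Printing Implicit Defensive.

Import Order.TTheory GRing.Theory Num.Theory.

Local Open Scope ring_scope.
Local Open Scope complex_scope.

Definition cexp (R : realType) (z : R[i]) : R[i] :=
  let: a +i* b := z in (expR a * cos b) +i* (expR a * sin b).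

(* Only meaningful for q > 0, where ln is the usual logarithm. *)
Definition qpow (R : realType) (q : R) (z : R[i]) : R[i] :=
  cexp (z * (ln q)%:C).

Definition qpoch (K : fieldType) (a p : K) (n : nat) : K :=
  \prod_(i < n) (1 - a * p ^+ i).

Definition qpochs (K : fieldType) (s : seq K) (p : K) (n : nat) : K :=
  \prod_(a <- s) qpoch a p n.

Definition qbinom (K : fieldType) (N n : nat) (p : K) : K :=
  qpoch p p N / (qpoch p p n * qpoch p p (N - n)).

Section Functions.
Variables (R : realType) (q : R) (N : nat).
Implicit Types (u s t v : R[i]) (n x y : nat).

Definition kfun u s n x : R[i] :=
  (-1) ^+ n * qpow q (n%:R * (s - u - 2^-1 * N%:R + 2^-1)) *
  \sum_(j < (minn n x).+1)
    qpochs [:: qpow q (2 * n%:R); qpow q (2 * x%:R);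
               - qpow q (- 2 * x%:R - 2 * s + 2 * N%:R)] (qpow q (- 2)) j
    / qpochs [:: qpow q (2 * N%:R); qpow q (- 2)] (qpow q (- 2)) j
    * qpow q (- 2 * j%:R).

Definition wfun n : R[i] :=
  qpow q (n%:R * (n%:R - N%:R)) * qbinom N n (qpow q 2).

Definition Rr x y s t v : R[i] :=
  \sum_(n < N.+1) kfun 1 s n x * kfun v t n y * wfun n.

End Functions.

Definition Wfun (R : realType) (N x : nat) (s : R[i]) (p : R) : R[i] :=
  (1 + qpow p (4 * x%:R + 2 * s - 2 * N%:R)) / (1 + qpow p (2 * s - 2 * N%:R))
  * (qpoch (- qpow p (2 * s - 2 * N%:R)) (qpow p 2) x
     / qpoch (- qpow p (2 * s + 2)) (qpow p 2) x)
  * (qpow p (- x%:R * (2 * s + 1 + x%:R - 2 * N%:R))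
     / qpoch (- qpow p (- 2 * s)) (qpow p 2) N)
  * qbinom N x (qpow p 2).

(* Main.v *)
(* Write p = q^2 and b = q^(2s-2N). Since k_{u,s}(n,x) = q^(-nu) k_{0,s}(n,x), and
   conjugation maps -conj(v)-2 to -v-2, the powers of q depending on v cancel as soon
   as one knows the orthogonality of the dual q-Krawtchouk functions
     sum_n w(n) k_{0,s}(n,x) k_{0,s}(n,x') = delta_{x,x'} / W(x,s;1/q)
   and its transpose, which is equivalent because the matrices are square.
   The phases combine with w(n) into the weight p^(n(n+1)/2) b^n [N n]_p, and what is left
   of k_{0,s}(n,x) is a polynomial of degree x in p^n. Its moment against p^(nj) is
   computed by the q-binomial theorem (sum over n) followed by a terminating
   q-Chu-Vandermonde sum; it has the factor (p^(j+1-x);p)_x, hence vanishes for j < x.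
   The case j = x and the leading coefficient give the norm. *)
Require Import Defs.
From HB Require Import structures.
From mathcomp Require Import all_boot all_order all_algebra.
From mathcomp Require Import complex.
From mathcomp Require Import reals sequences exp trigo.
From mathcomp Require Import ring zify.

Set Implicit Arguments.
Unset Strict Implicit.
Unset Printing Implicit Defensive.

Import Order.TTheory GRing.Theory Num.Theory.

Local Open Scope complex_scope.
Local Open Scope ring_scope.

(** * q-Pochhammer symbols and q-binomial coefficients *)

Lemma qpoch0 (K : fieldType) (a p : K) : qpoch a p 0 = 1.
Proof. by rewrite /qpoch big_ord0. Qed.

Lemma qpochSr (K : fieldType) (a p : K) n :
  qpoch a p n.+1 = qpoch a p n * (1 - a * p ^+ n).
Proof. by rewrite /qpoch big_ord_recr. Qed.

Lemma qpochD (K : fieldType) (a p : K) m n :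
  qpoch a p (m + n) = qpoch a p m * qpoch (a * p ^+ m) p n.
Proof.
elim: n => [|n IHn]; first by rewrite addn0 qpoch0 mulr1.
by rewrite addnS !qpochSr IHn -!mulrA exprD.
Qed.

Lemma qpochSl (K : fieldType) (a p : K) n :
  qpoch a p n.+1 = (1 - a) * qpoch (a * p) p n.
Proof. by rewrite -add1n qpochD expr1 qpochSr qpoch0 mul1r expr0 mulr1. Qed.

Lemma qpoch_eq0 (K : fieldType) (a p : K) n i :
  (i < n)%N -> a * p ^+ i = 1 -> qpoch a p n = 0.
Proof.
move=> lt_in api; rewrite -(subnKC lt_in) qpochD qpochSr api.
by rewrite subrr mulr0 mul0r.
Qed.

Lemma qpoch_neq0 (K : fieldType) (a p : K) n :
  (forall i, (i < n)%N -> a * p ^+ i != 1) -> qpoch a p n != 0.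
Proof.
move=> api; apply/prodf_neq0 => i _.
by rewrite subr_eq0 eq_sym api.
Qed.

(** Factor by factor, 1 - a^-1 p^-i = -a^-1 p^-i (1 - a p^i). *)
Lemma qpochV (K : fieldType) (a p : K) n : a != 0 -> p != 0 ->
  qpoch a^-1 p^-1 n = (-1) ^+ n * a ^- n * p ^- 'C(n, 2) * qpoch a p n.
Proof.
move=> a0 p0; elim: n => [|n IHn].
  by rewrite !qpoch0 bin0n !expr0 invr1 !mulr1.
rewrite !qpochSr IHn binS bin1 exprD !exprS exprVn.
field.
by rewrite a0 !expf_neq0.
Qed.

(** The first symbol consists of the last n factors of (p;p)_(m+n), in descending order. *)
Lemma qpoch_rev (K : fieldType) (p : K) m n : p != 0 ->
  qpoch (p ^+ (m + n)) p^-1 n * qpoch p p m = qpoch p p (m + n).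
Proof.
move=> p0; elim: n => [|n IHn]; first by rewrite addn0 qpoch0 mul1r.
rewrite qpochSl addnS qpochSr -exprS -IHn [p ^+ (m + n).+1 in X in qpoch X _ _]exprSr mulfK //.
by ring.
Qed.

Lemma qfact_neq0 (K : fieldType) (p : K) n :
  (forall i, p ^+ i.+1 != 1) -> qpoch p p n != 0.
Proof. by move=> hp; apply: qpoch_neq0 => i _; rewrite -exprS. Qed.

Lemma qbinom0 (K : fieldType) (p : K) n :
  (forall i, p ^+ i.+1 != 1) -> qbinom n 0 p = 1.
Proof. by move=> hp; rewrite /qbinom subn0 qpoch0 mul1r divff ?qfact_neq0. Qed.

Lemma qbinomn (K : fieldType) (p : K) n :
  (forall i, p ^+ i.+1 != 1) -> qbinom n n p = 1.
Proof. by move=> hp; rewrite /qbinom subnn qpoch0 mulr1 divff ?qfact_neq0. Qed.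

(** Pascal's rule. The strict bound matters: [qbinom n n.+1 p] is not 0, because the subtraction in
    its definition is truncated. *)
Lemma qbinomS (K : fieldType) (p : K) n i :
    (forall i, p ^+ i.+1 != 1) -> (i < n)%N ->
  qbinom n.+1 i.+1 p = p ^+ i.+1 * qbinom n i.+1 p + qbinom n i p.
Proof.
move=> hp lt_in; rewrite /qbinom subSS.
rewrite -(subnKC lt_in) addSn subSS subSn ?leq_addr // !addKn.
move: (n - i.+1)%N => k.
rewrite (qpochSr p p (i + k).+1) (qpochSr p p k) (qpochSr p p i) -!exprS.
have -> : p ^+ (i + k).+2 = p ^+ i.+1 * p ^+ k.+1 by rewrite -exprD addSn addnS.
field.
have:= qfact_neq0 i hp; have:= qfact_neq0 k hp => -> ->.
by rewrite !subr_eq0 ![1 == _]eq_sym (negPf (hp i)) (negPf (hp k)).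
Qed.

(** * The q-Chu-Vandermonde sum and the q-binomial theorem *)

(* A homogeneous form of the q-Chu-Vandermonde sum; [a = 0] is the q-binomial theorem. *)
Lemma qChu_Vandermonde (K : fieldType) (p a y : K) n :
    (forall i, p ^+ i.+1 != 1) ->
  \sum_(i < n.+1) qbinom n i p * (-1) ^+ i * p ^+ 'C(i, 2) * y ^+ i
    * qpoch a p i * qpoch (a * y * p ^+ i) p (n - i) = qpoch y p n.
Proof.
move=> hp; elim: n y => [|n IHn] y.
  by rewrite big_ord1 subn0 !qpoch0 qbinom0 // !expr0 !mulr1.
rewrite qpochSl -(IHn (y * p)) mulr_sumr.
pose F (i : nat) : K := (-1) ^+ i * p ^+ 'C(i, 2) * y ^+ i
    * qpoch a p i * qpoch (a * y * p ^+ i) p (n.+1 - i).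
(* The extreme terms i = 0 and i = n + 1 are split off; Pascal's rule covers the indices in
   between. *)
have E1 : \sum_(i < n.+2) qbinom n.+1 i p * F i =
   \sum_(i < n.+1) (p ^+ i * qbinom n i p) * F i + \sum_(i < n.+1) qbinom n i p * F i.+1.
  rewrite big_ord_recl [in RHS]big_ord_recl big_ord_recr [X in _ + X = _]/=.
  rewrite [in RHS]big_ord_recr /= /bump /= !add1n.
  rewrite !qbinom0 // !qbinomn // expr0 !mul1r -!addrA; congr (_ + _).
  rewrite !addrA; congr (_ + _).
  rewrite -big_split /=; apply: eq_bigr => i _.
  by rewrite /bump /= !add1n qbinomS // mulrDl.
transitivity (\sum_(i < n.+2) qbinom n.+1 i p * F i).
  by apply: eq_bigr => i _; rewrite /F !mulrA.
(* Termwise, p^i (1 - a y p^i) - p^i y (1 - a p^i) = p^i (1 - y). *)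
rewrite E1 -big_split; apply: eq_bigr => i _ /=.
rewrite /F subSS subSn -1?ltnS // (qpochSl (a * y * p ^+ i)) (qpochSr a) binS bin1.
rewrite -!mulrA -!exprSr !mulrA !exprD exprMn !exprS -[a * y * p * _]mulrA -exprS mulrA.
move: (qpoch _ _ _) (qpoch _ _ _) => A B.
rewrite !exprS; ring.
Qed.

Lemma qbinomial_theorem (K : fieldType) (p z : K) n :
    (forall i, p ^+ i.+1 != 1) ->
  \sum_(i < n.+1) qbinom n i p * p ^+ 'C(i, 2) * z ^+ i = qpoch (- z) p n.
Proof.
move=> hp; rewrite -(qChu_Vandermonde 0 (- z) n hp); apply: eq_bigr => i _.
have qpoch0l m : qpoch 0 p m = 1.
  by rewrite /qpoch big1 // => k _; rewrite mul0r subr0.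
rewrite !mul0r !qpoch0l !mulr1 [(- z) ^+ i]exprNn.
by have s1 := sqrr_sign K i; ring: s1.
Qed.

(** * Base reversal and moments of falling q-factorials *)

Lemma bin2D m n : ('C(m + n, 2) = 'C(m, 2) + 'C(n, 2) + m * n)%N.
Proof.
elim: n => [|n IHn]; first by rewrite addn0 muln0 !addn0.
by rewrite addnS !binS !bin1 IHn; lia.
Qed.

Lemma qpoch_mirror (K : fieldType) (a p : K) n : p != 0 ->
  qpoch (a * p ^+ n) p^-1 n = qpoch (a * p) p n.
Proof.
move=> p0; elim: n => [|n IHn]; first by rewrite !qpoch0.
by rewrite qpochSl exprSr mulrA mulfK // IHn qpochSr; ring.
Qed.

Lemma qbinomV (K : fieldType) (p : K) m n :
    p != 0 -> (forall i, p ^+ i.+1 != 1) ->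
  qbinom (m + n) m p^-1 = p ^- (m * n) * qbinom (m + n) m p.
Proof.
move=> p0 hp; rewrite /qbinom addKn !qpochV // bin2D !exprD.
field.
by rewrite !expf_neq0 ?oppr_eq0 ?oner_eq0 ?qfact_neq0.
Qed.

(** As (p^n;p^-1)_i is a falling q-factorial, this is the analogue of C(N,n) n...(n-i+1) /
    (N...(N-i+1)) = C(N-i,n-i). *)
Lemma qbinom_falling (K : fieldType) (p : K) i m k :
    p != 0 -> (forall i, p ^+ i.+1 != 1) -> (m <= k)%N ->
  qbinom (i + k) (i + m) p
    * (qpoch (p ^+ (i + m)) p^-1 i / qpoch (p ^+ (i + k)) p^-1 i) = qbinom k m p.
Proof.
move=> p0 hp le_mk.
have E n : qpoch (p ^+ (i + n)) p^-1 i = qpoch p p (i + n) / qpoch p p n.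
  by rewrite addnC -qpoch_rev // mulfK ?qfact_neq0.
rewrite !E /qbinom subnDl.
by field; rewrite !qfact_neq0.
Qed.

Lemma qbinomial_moment (K : fieldType) (p c : K) N i :
    p != 0 -> (forall i, p ^+ i.+1 != 1) -> (i <= N)%N ->
  \sum_(n < N.+1) p ^+ 'C(n.+1, 2) * c ^+ n * qbinom N n p
      * (qpoch (p ^+ n) p^-1 i / qpoch (p ^+ N) p^-1 i)
    = p ^+ 'C(i.+1, 2) * c ^+ i * qpoch (- (c * p ^+ i.+1)) p (N - i).
Proof.
move=> p0 hp le_iN; rewrite -(subnKC le_iN) addKn -addnS big_split_ord /=.
move: (N - i)%N => k.
(* For n < i the falling factorial contains 1 - p^n p^-n = 0. With n = i + m the rest is a
   q-binomial sum at z = c p^(i+1). *)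
rewrite big1 ?add0r => [|n _]; last first.
  by rewrite (@qpoch_eq0 _ _ _ _ n) // ?mul0r ?mulr0 // exprVn divff // expf_neq0.
rewrite -qbinomial_theorem // mulr_sumr; apply: eq_bigr => m _.
rewrite -mulrA qbinom_falling -1?ltnS // -addSn bin2D [c ^+ (i + m)]exprD.
by rewrite [_ ^+ (_ + _ * _)]exprD exprM [in LHS]exprD exprMn; ring.
Qed.

(** * Dual q-Krawtchouk functions: moments and orthogonality *)

(* Closed form, free of [p^-1], of the [i]-th coefficient of the paper's sum; see [dqK_coefE]. *)
Definition dqK_coef (K : fieldType) (p b : K) x i : K :=
  (-1) ^+ i * qbinom x i p * qpoch (- (b * p ^+ x)) p i / (b * p ^+ x) ^+ i.

(** The sum in k_{u,s}(n,x), as a polynomial in p^n in the basis (p^n;p^-1)_i. The range reaches x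
    instead of min(n,x), since the basis elements with i > n vanish at p^n. *)
Definition dqK (K : fieldType) (p b : K) N n x : K :=
  \sum_(i < x.+1)
    qpoch (p ^+ n) p^-1 i / qpoch (p ^+ N) p^-1 i * dqK_coef p b x i.

Definition dqK_weight (K : fieldType) (p b : K) N n : K :=
  p ^+ 'C(n.+1, 2) * b ^+ n * qbinom N n p.

Lemma dqK_moment (K : fieldType) (p b : K) N x j :
    p != 0 -> (forall i, p ^+ i.+1 != 1) -> b != 0 -> (x <= N)%N ->
  \sum_(n < N.+1) dqK_weight p b N n * p ^+ n ^+ j * dqK p b N n x
    = qpoch (p ^+ j.+1 / p ^+ x) p x * qpoch (- (b * p ^+ (j + x).+1)) p (N - x).
Proof.
move=> p0 hp b0 le_xN.
under eq_bigr do rewrite mulr_sumr.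
(* For fixed i the sum over n is a falling-factorial moment with c = b p^j; the sum over i is
   q-Chu-Vandermonde with a = -b p^x and y = p^(j+1-x). *)
rewrite exchange_big /= -(qChu_Vandermonde (- (b * p ^+ x)) _ _ hp) mulr_suml.
apply: eq_bigr => i _.
have le_ix : (i <= x)%N by rewrite -ltnS.
transitivity (dqK_coef p b x i * (p ^+ 'C(i.+1, 2) * (b * p ^+ j) ^+ i
    * qpoch (- (b * p ^+ j * p ^+ i.+1)) p (N - i))).
  rewrite -qbinomial_moment ?(leq_trans le_ix) // mulr_sumr.
  apply: eq_bigr => n _; rewrite /dqK_weight exprMn exprAC.
  move: (p ^+ j ^+ n) => e; ring.
(* This split makes the last N - x factors independent of i. *)
have -> : (N - i = (x - i) + (N - x))%N by lia.
rewrite qpochD.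
have -> : - (b * p ^+ j * p ^+ i.+1) = - (b * p ^+ x) * (p ^+ j.+1 / p ^+ x) * p ^+ i.
  by rewrite !exprS; field; rewrite expf_neq0.
have -> : - (b * p ^+ x) * (p ^+ j.+1 / p ^+ x) * p ^+ i * p ^+ (x - i)
    = - (b * p ^+ (j + x).+1).
  rewrite -mulrA -exprD subnKC // -addSn exprD; field; by rewrite expf_neq0.
rewrite /dqK_coef binS bin1 exprD !exprMn exprVn exprS exprMn.
by field; rewrite !expf_neq0.
Qed.

(** Only the function at x' is expanded in powers of p^n; the one at x stays whole, so that
    [dqK_moment] applies to each power. *)
Lemma dqK_gram_expand (K : fieldType) (p b : K) N x x' :
    p != 0 -> (forall i, p ^+ i.+1 != 1) -> b != 0 -> (x <= N)%N ->
  \sum_(n < N.+1) dqK_weight p b N n * dqK p b N n x * dqK p b N n x'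
    = \sum_(i < x'.+1) \sum_(j < i.+1)
        dqK_coef p b x' i / qpoch (p ^+ N) p^-1 i
        * (qbinom i j p^-1 * (-1) ^+ j * p ^- 'C(j, 2))
        * (qpoch (p ^+ j.+1 / p ^+ x) p x
           * qpoch (- (b * p ^+ (j + x).+1)) p (N - x)).
Proof.
move=> p0 hp b0 le_xN.
have hp' i : p^-1 ^+ i.+1 != 1 by rewrite exprVn invr_eq1.
under eq_bigr do rewrite mulr_sumr.
rewrite exchange_big; apply: eq_bigr => i _ /=.
have E n : qpoch (p ^+ n) p^-1 i =
    \sum_(j < i.+1) qbinom i j p^-1 * (-1) ^+ j * p ^- 'C(j, 2) * p ^+ n ^+ j.
  rewrite -[p ^+ n in LHS]opprK -qbinomial_theorem //; apply: eq_bigr => j _.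
  rewrite exprVn [in LHS]exprNn; move: (p ^+ n ^+ j) => e; ring.
under [RHS]eq_bigr => j _ do rewrite -dqK_moment // mulr_sumr.
rewrite exchange_big; apply: eq_bigr => n _ /=; rewrite E.
move: (dqK_weight p b N n) (dqK p b N n x) => w k.
rewrite !(mulr_suml, mulr_sumr); apply: eq_bigr => j _.
move: (p ^+ n ^+ j) => e; ring.
Qed.

Lemma dqK_orth_lt (K : fieldType) (p b : K) N x x' :
    p != 0 -> (forall i, p ^+ i.+1 != 1) -> b != 0 -> (x' < x <= N)%N ->
  \sum_(n < N.+1) dqK_weight p b N n * dqK p b N n x * dqK p b N n x' = 0.
Proof.
move=> p0 hp b0 /andP[lt_x'x le_xN]; rewrite dqK_gram_expand //.
rewrite big1 // => i _; rewrite big1 // => j _.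
(* As j <= i <= x' < x, the factor of index x-j-1 is 1 - p^(j+1-x) p^(x-j-1) = 0. *)
rewrite (@qpoch_eq0 _ (p ^+ j.+1 / p ^+ x) _ _ (x - j.+1)) ?mul0r ?mulr0 //.
  by have := ltn_ord i; have := ltn_ord j; lia.
rewrite mulrAC -exprD subnKC ?divff ?expf_neq0 //.
by have := ltn_ord i; have := ltn_ord j; lia.
Qed.

Lemma dqK_norm (K : fieldType) (p b : K) N x :
    p != 0 -> (forall i, p ^+ i.+1 != 1) -> b != 0 -> (x <= N)%N ->
  \sum_(n < N.+1) dqK_weight p b N n * dqK p b N n x * dqK p b N n x
    = p ^- 'C(x, 2) * qpoch (- (b * p ^+ x)) p x * qpoch p p x
      * qpoch (- (b * p ^+ (x + x).+1)) p (N - x)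
      / (qpoch (p ^+ N) p^-1 x * (b * p ^+ x) ^+ x).
Proof.
move=> p0 hp b0 le_xN; rewrite dqK_gram_expand //.
have hp' i : p^-1 ^+ i.+1 != 1 by rewrite exprVn invr_eq1.
have Z j : (j < x)%N -> qpoch (p ^+ j.+1 / p ^+ x) p x = 0.
  move=> lt_jx; apply: (@qpoch_eq0 _ _ _ _ (x - j.+1)); first by lia.
  by rewrite mulrAC -exprD subnKC ?divff ?expf_neq0.
(* By [Z] only i = j = x survives: the leading coefficient times the x-th moment. *)
rewrite big_ord_recr big1 ?add0r /= => [|i _]; last first.
  rewrite big1 // => j _; rewrite Z ?mul0r ?mulr0 //.
  by have := ltn_ord i; have := ltn_ord j; lia.
rewrite big_ord_recr big1 ?add0r /= => [|j _]; last by rewrite Z ?mul0r ?mulr0.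
rewrite /dqK_coef !qbinomn // [p ^+ x.+1]exprS mulfK ?expf_neq0 //.
have s1 := sqrr_sign K x.
rewrite [in RHS]invfM.
move: (_ ^+ x)^-1 (qpoch (p ^+ N) _ _)^-1 (p ^- _) => e f g; ring: s1.
Qed.

(** * The weight in x and the norm *)

(** W(x,s;q^-1) in the variables p = q^2 and b = q^(2s-2N), over any field; see [WfunE]. *)
Definition dqK_dual_weight (K : fieldType) (p b : K) N x : K :=
  (1 + (p ^+ (x + x))^-1 / b) / (1 + b^-1)
  * (qpoch (- b^-1) p^-1 x / qpoch (- (b * p ^+ N.+1)^-1) p^-1 x)
  * (b ^+ x * p ^+ 'C(x.+1, 2) / qpoch (- (b * p ^+ N)) p^-1 N)
  * qbinom N x p^-1.

Lemma dqK_norm_dual_weight (K : fieldType) (p b : K) N x :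
    p != 0 -> (forall i, p ^+ i.+1 != 1) -> b != 0 ->
    (forall i, 1 + b * p ^+ i != 0) -> (x <= N)%N ->
  (\sum_(n < N.+1) dqK_weight p b N n * dqK p b N n x * dqK p b N n x)
    * dqK_dual_weight p b N x = 1.
Proof.
move=> p0 hp b0 hb le_xN; rewrite dqK_norm // /dqK_dual_weight.
rewrite -(subnKC le_xN); move: (N - x)%N => k {N le_xN}; rewrite addKn.
have px0 i : p ^+ i != 0 by rewrite expf_neq0.
(* All factors involving b become quotients of values Q(m) = (-b;p)_m, nonzero by [hb]. *)
pose Q := qpoch (- b) p.
have Q0 i : Q i != 0.
  by apply: qpoch_neq0 => j _; rewrite -subr_eq0 -oppr_eq0 opprB mulNr opprK.
have EQ m n : qpoch (- (b * p ^+ m)) p n = Q (m + n)%N / Q m.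
  by rewrite /Q qpochD mulNr mulrAC divff ?mul1r //; apply: Q0.
have ES m : 1 + b * p ^+ m = Q m.+1 / Q m.
  by rewrite /Q qpochSr mulNr opprK mulrAC divff ?mul1r //; apply: Q0.
rewrite -[- (b * p ^+ (x + k))]mulNr qpoch_mirror // mulNr.
rewrite -!invrN !qpochV ?oppr_eq0 ?mulf_neq0 // -/(Q x) qbinomV //.
rewrite -[b * p]/(b * p ^+ 1) !EQ.
have -> : qpoch (p ^+ (x + k)) p^-1 x = qpoch p p (x + k) / qpoch p p k.
  by rewrite addnC -qpoch_rev // mulfK ?qfact_neq0.
have -> : 1 + (p ^+ (x + x))^-1 / b = Q (x + x).+1 / Q (x + x)%N / (b * p ^+ (x + x)).
  by rewrite -ES; field; rewrite b0 px0.
have -> : 1 + b^-1 = Q 1%N / b.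
  by rewrite /Q qpochSr qpoch0 mul1r expr0 mulr1 opprK; field.
(* Q(2x+k+1) arises both from the norm and from the weight; its two indices are aligned to
   cancel. *)
have -> : ((x + x).+1 + k = (x + k).+1 + x)%N by lia.
rewrite add1n /qbinom addKn binS bin1 [p ^+ (x + k).+1]exprS !exprD
  !(exprNn (b * _)) (exprNn b).
rewrite !exprMn mulnC exprM.
move: (p ^+ x ^+ x) (p ^+ k ^+ x) (expf_neq0 x (px0 x)) (expf_neq0 x (px0 k)).
move=> e f e0 f0; field.
by rewrite !qfact_neq0 // !Q0 b0 e0 f0 !expf_neq0 ?oppr_eq0 ?oner_eq0.
Qed.

Lemma dqK_dual_weight_neq0 (K : fieldType) (p b : K) N x :
    p != 0 -> (forall i, p ^+ i.+1 != 1) -> b != 0 ->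
    (forall i, 1 + b * p ^+ i != 0) -> (x <= N)%N ->
  dqK_dual_weight p b N x != 0.
Proof.
move=> p0 hp b0 hb le_xN; apply/eqP => V0.
have /eqP := dqK_norm_dual_weight p0 hp b0 hb le_xN.
by rewrite V0 mulr0 eq_sym oner_eq0.
Qed.

Lemma dqK_orth (K : fieldType) (p b : K) N (x x' : 'I_N.+1) :
    p != 0 -> (forall i, p ^+ i.+1 != 1) -> b != 0 ->
    (forall i, 1 + b * p ^+ i != 0) ->
  \sum_(n < N.+1) dqK_weight p b N n * dqK p b N n x * dqK p b N n x'
    = (x == x')%:R / dqK_dual_weight p b N x.
Proof.
move=> p0 hp b0 hb.
have leN (y : 'I_N.+1) : (y <= N)%N by rewrite -ltnS.
case: (eqVneq x x') => [<-|ne_xx'].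
  apply: (mulIf (dqK_dual_weight_neq0 p0 hp b0 hb (leN x))).
  by rewrite dqK_norm_dual_weight // divfK ?dqK_dual_weight_neq0.
rewrite mul0r; move: ne_xx'; rewrite -val_eqE neq_ltn => /orP[] lt_xx'.
  under eq_bigr do rewrite mulrAC.
  by rewrite dqK_orth_lt // lt_xx' leN.
by rewrite dqK_orth_lt // lt_xx' leN.
Qed.

(** * Transposition and convolution of orthogonality relations *)

(** The hypothesis says M M' = 1 for square matrices, so M' M = 1. Keeping w j on the left avoids a
    division by w. *)
Lemma orth_transpose (K : fieldType) n (A : 'I_n -> 'I_n -> K) (w V : 'I_n -> K) :
    (forall x, V x != 0) ->
    (forall x x', \sum_i w i * A i x * A i x' = (x == x')%:R / V x) ->
  forall i j, \sum_x A i x * A j x * V x * w j = (i == j)%:R.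
Proof.
move=> V0 orthA i j.
pose M := \matrix_(x, k) (w k * A k x); pose M' := \matrix_(k, x) (A k x * V x).
have /mulmx1C/matrixP/(_ i j) : M *m M' = 1%:M.
  apply/matrixP => x x'; rewrite !mxE.
  under eq_bigr do rewrite !mxE mulrA.
  rewrite -mulr_suml orthA; case: eqVneq => [->|_]; first by rewrite divfK.
  by rewrite !mul0r.
rewrite !mxE => <-; apply: eq_bigr => x _; rewrite !mxE; ring.
Qed.

(** Summing over x first collapses the double sum to i = j, where e and f cancel. They will carry
    the dependence on v, while A and B are the functions for s and t. *)
Lemma orth_convolution (K : fieldType) n (A B : 'I_n -> 'I_n -> K)
    (w V e f : 'I_n -> K) :
    (forall i j, \sum_x A i x * A j x * V x * w j = (i == j)%:R) ->
    (forall i, e i * f i = 1) ->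
  forall y y',
    \sum_x (\sum_i e i * A i x * B i y * w i) * (\sum_j f j * A j x * B j y' * w j) * V x
    = \sum_i w i * B i y * B i y'.
Proof.
move=> orthA ef1 y y'.
transitivity (\sum_i \sum_j (e i * B i y * w i * f j * B j y')
                * \sum_x A i x * A j x * V x * w j).
  under eq_bigr do rewrite mulr_suml mulr_suml.
  rewrite exchange_big; apply: eq_bigr => i _ /=.
  under eq_bigr do rewrite mulr_sumr mulr_suml.
  rewrite exchange_big; apply: eq_bigr => j _ /=.
  by rewrite mulr_sumr; apply: eq_bigr => x _; ring.
apply: eq_bigr => i _; rewrite (bigD1 i) //= orthA eqxx big1 => [|j /negPf ne_ji].
  rewrite addr0 mulr1 -[RHS]mul1r -(ef1 i); ring.
by rewrite orthA eq_sym ne_ji mulr0.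
Qed.

(** * Complex exponential and complex powers of q *)

Lemma cexpD (R : realType) (z z' : R[i]) : cexp (z + z') = cexp z * cexp z'.
Proof.
case: z z' => [a b] [c d]; rewrite /cexp /= expRD cosD sinD.
by apply/eqP; rewrite eq_complex /=; apply/andP; split; apply/eqP; ring.
Qed.

Lemma cexp_conj (R : realType) (z : R[i]) : (cexp z)^* = cexp z^*.
Proof. by case: z => [a b]; rewrite /cexp /= cosN sinN mulrN. Qed.

Lemma cexp_real (R : realType) (a : R) : cexp a%:C = (expR a)%:C.
Proof. by rewrite /cexp /= cos0 sin0 mulr1 mulr0. Qed.

Lemma cexp0 (R : realType) : cexp (0 : R[i]) = 1.
Proof. by rewrite -[0 : R[i]]/(0%:C) cexp_real expR0. Qed.

Lemma cexp_neq0 (R : realType) (z : R[i]) : cexp z != 0.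
Proof.
apply/eqP => z0; have /eqP := cexp0 R.
by rewrite -(subrr z) cexpD z0 mul0r eq_sym oner_eq0.
Qed.

Lemma qpowD (R : realType) (q : R) (z z' : R[i]) :
  qpow q (z + z') = qpow q z * qpow q z'.
Proof. by rewrite /qpow mulrDl cexpD. Qed.

Lemma qpow0 (R : realType) (q : R) : qpow q (0 : R[i]) = 1.
Proof. by rewrite /qpow mul0r cexp0. Qed.

Lemma qpow_neq0 (R : realType) (q : R) (z : R[i]) : qpow q z != 0.
Proof. exact: cexp_neq0. Qed.

Lemma qpowN (R : realType) (q : R) (z : R[i]) : qpow q (- z) = (qpow q z)^-1.
Proof.
apply: (mulIf (qpow_neq0 q z)).
by rewrite -qpowD addNr qpow0 mulVf ?qpow_neq0.
Qed.

Lemma qpowV (R : realType) (q : R) (z : R[i]) : 0 < q ->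
  qpow q^-1 z = (qpow q z)^-1.
Proof. by move=> q0; rewrite -qpowN /qpow lnV // rmorphN mulrN mulNr. Qed.

Lemma qpowMn (R : realType) (q : R) (z : R[i]) n :
  qpow q (n%:R * z) = qpow q z ^+ n.
Proof.
elim: n => [|n IHn]; first by rewrite mul0r qpow0.
by rewrite mulrSr mulrDl mul1r qpowD IHn exprSr.
Qed.

Lemma conj_realC (R : realType) (a : R) : a%:C^* = a%:C.
Proof. exact: conjc_real. Qed.

Lemma qpow_conj (R : realType) (q : R) (z : R[i]) : (qpow q z)^* = qpow q z^*.
Proof. by rewrite /qpow cexp_conj rmorphM /= conj_realC. Qed.

Lemma qpow_real (R : realType) (q a : R) : qpow q a%:C = (expR (a * ln q))%:C.
Proof. by rewrite /qpow -rmorphM cexp_real. Qed.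

Lemma qpow_neq1 (R : realType) (q a : R) : 0 < q -> q != 1 -> a != 0 ->
  qpow q a%:C != 1.
Proof.
move=> q0 q1 a0; rewrite qpow_real (inj_eq (@complexI _) _ 1) -(expR0 R) (inj_eq (@expR_inj R)).
by rewrite mulf_neq0 // ln_eq0.
Qed.

(** A real exponent gives a positive power; through this the reality of s keeps the factors 1 + b
    p^i away from 0. *)
Lemma qpow_real_1D_neq0 (R : realType) (q a : R) : 1 + qpow q a%:C != 0.
Proof.
rewrite qpow_real -(rmorph1 (@real_complex R)) -rmorphD.
by rewrite (inj_eq (@complexI _) _ 0) gt_eqF // addr_gt0 // expR_gt0.
Qed.

(** * Translation of k, w and W into p = q^2 and b = q^(2s-2N) *)

Lemma bin2_natr (K : pzRingType) n : 2 * 'C(n.+1, 2)%:R = n%:R * (n%:R + 1) :> K.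
Proof.
rewrite -natrM -[X in _ + X]/(1%:R) -natrD -natrM; congr _%:R.
by elim: n => [|n IHn] //; rewrite binS bin1 mulnDr IHn; lia.
Qed.

(** Base reversal in one symbol above and one below the bar: the powers p^-C(i,2) cancel, and the
    remaining p^i absorbs p^-i. *)
Lemma dqK_coefE (K : fieldType) (p b : K) x i :
    p != 0 -> (forall i, p ^+ i.+1 != 1) -> b != 0 -> (i <= x)%N ->
  qpoch (p ^+ x) p^-1 i * qpoch (- (b * p ^+ x)^-1) p^-1 i / qpoch p^-1 p^-1 i * p ^- i
    = dqK_coef p b x i.
Proof.
move=> p0 hp b0 le_ix; rewrite /dqK_coef /qbinom -(subnK le_ix) addnK -qpoch_rev //.
rewrite -invrN !qpochV ?oppr_eq0 ?mulf_neq0 ?expf_neq0 // (exprNn (b * _)).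
rewrite -[X in _ = X * _ * _ / _]invr_sign; move: (x - i)%N => k.
have b1 : (b * p ^+ (k + i)) ^+ i != 0 by rewrite expf_neq0 ?mulf_neq0 ?expf_neq0.
move: (_ ^+ i) b1 => e e0.
by field; rewrite !expf_neq0 ?qfact_neq0 ?oppr_eq0 ?oner_eq0 // e0.
Qed.

Lemma qpow2_exp_neq1 (R : realType) (q : R) i :
  0 < q -> q != 1 -> qpow q 2 ^+ i.+1 != 1.
Proof.
move=> q0 q1; rewrite -qpowMn -natrM -(rmorph_nat (@real_complex R)).
by rewrite qpow_neq1 ?pnatr_eq0.
Qed.

Lemma kfunE (R : realType) (q : R) N (u s : R[i]) n x :
    0 < q -> q != 1 ->
  kfun q N u s n x = (-1) ^+ n * qpow q (n%:R * (s - u - 2^-1 * N%:R + 2^-1))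
    * dqK (qpow q 2) (qpow q (2 * s - 2 * N%:R)) N n x.
Proof.
move=> q0 q1; rewrite /kfun; congr (_ * _).
have p0 := qpow_neq0 q 2; have b0 := qpow_neq0 q (2 * s - 2 * N%:R).
have hp i := qpow2_exp_neq1 i q0 q1.
have E2 z : qpow q (2 * z%:R) = qpow q 2 ^+ z by rewrite mulrC qpowMn.
have EN : qpow q (- 2) = (qpow q 2)^-1 by rewrite qpowN.
have EV j : qpow q (- 2 * j%:R) = qpow q 2 ^- j by rewrite mulNr qpowN E2.
have EB : qpow q (- 2 * x%:R - 2 * s + 2 * N%:R)
    = (qpow q (2 * s - 2 * N%:R) * qpow q 2 ^+ x)^-1.
  by rewrite -E2 -qpowD -qpowN; congr qpow; ring.
rewrite !E2 EN EB; move: (qpow q 2) (qpow q (2 * s - 2 * N%:R)) p0 b0 hp EV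
  => p b p0 b0 hp EV {E2 EN EB}.
pose F j := qpochs [:: p ^+ n; p ^+ x; - (b * p ^+ x)^-1] p^-1 j
  / qpochs [:: p ^+ N; p^-1] p^-1 j * qpow q (- 2 * j%:R).
(* The range is extended from min(n,x) to x; the added terms have j > n and contain the factor 1 -
   p^n p^-n. *)
rewrite (big_ord_widen x.+1 F) ?ltnS ?geq_minr //.
rewrite big_mkcond; apply: eq_bigr => j _ /=; rewrite /F EV.
rewrite /qpochs !big_cons !big_nil !mulr1 -dqK_coefE -1?ltnS // !ltnS.
case: leqP => [_ | lt_j].
  rewrite [(qpoch (p ^+ N) _ _ * _)^-1]invfM.
  move: (_^-1) (qpoch p^-1 p^-1 j)^-1 (p ^- j) => e f g; ring.
rewrite (@qpoch_eq0 _ (p ^+ n) _ _ n) ?mul0r //.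
  by have := ltn_ord j; lia.
by rewrite exprVn divff // expf_neq0.
Qed.

Lemma WfunE (R : realType) (q : R) N (s : R[i]) x : 0 < q ->
  Wfun N x s q^-1
    = dqK_dual_weight (qpow q 2) (qpow q (2 * s - 2 * N%:R)) N x.
Proof.
move=> q0; rewrite /Wfun /dqK_dual_weight !qpowV //.
set p := qpow q 2; set b := qpow q (2 * s - 2 * N%:R).
have p0 : p != 0 := qpow_neq0 _ _; have b0 : b != 0 := qpow_neq0 _ _.
have E2 z : qpow q (2 * z%:R) = p ^+ z by rewrite mulrC qpowMn.
have -> : (qpow q (4 * x%:R + 2 * s - 2 * N%:R))^-1 = (p ^+ (x + x))^-1 / b.
  by rewrite -invfM -E2 -qpowD; congr (qpow _ _)^-1; rewrite (natrD _ x x); ring.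
have -> : qpow q (2 * s + 2) = b * p ^+ N.+1.
  by rewrite -E2 -qpowD; congr qpow; rewrite mulrS; ring.
have -> : (qpow q (- 2 * s))^-1 = b * p ^+ N.
  by rewrite -qpowN -E2 -qpowD; congr qpow; ring.
have -> // : (qpow q (- x%:R * (2 * s + 1 + x%:R - 2 * N%:R)))^-1 = b ^+ x * p ^+ 'C(x.+1, 2).
rewrite -qpowN -qpowMn -E2 -qpowD; congr qpow.
rewrite bin2_natr; ring.
Qed.

(** The exponents of q agree: n(2s-N+1) + n(n-N) = n(n+1) + n(2s-2N). *)
Lemma wfunE (R : realType) (q : R) N (s : R[i]) n :
  qpow q (n%:R * (s - 2^-1 * N%:R + 2^-1)) ^+ 2 * wfun q N n
    = dqK_weight (qpow q 2) (qpow q (2 * s - 2 * N%:R)) N n.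
Proof.
rewrite /dqK_weight /wfun -!qpowMn mulrA -!qpowD; congr (qpow _ _ * _).
by rewrite [_ * 2]mulrC bin2_natr; field.
Qed.

Lemma qpow_base_1D_neq0 (R : realType) (q s : R) N i :
  1 + qpow q (2 * s%:C - 2 * N%:R) * qpow q 2 ^+ i != 0.
Proof.
rewrite -qpowMn -qpowD.
have -> : 2 * s%:C - 2 * N%:R + i%:R * 2 = (2 * s - 2 * N%:R + i%:R * 2)%:C.
  by rewrite !(rmorphD, rmorphN, rmorphM) !rmorph_nat.
exact: qpow_real_1D_neq0.
Qed.

Lemma kfun_orth (R : realType) (q s : R) N (x x' : 'I_N.+1) : 0 < q -> q != 1 ->
  \sum_(n < N.+1) wfun q N n * kfun q N 0 s%:C n x * kfun q N 0 s%:C n x'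
    = (x == x')%:R / Wfun N x s%:C q^-1.
Proof.
move=> q0 q1; rewrite WfunE // -dqK_orth ?qpow_neq0 //; last first.
- by move=> i; apply: qpow_base_1D_neq0.
- by move=> i; apply: qpow2_exp_neq1.
apply: eq_bigr => n _; rewrite !kfunE // subr0 -wfunE.
have s1 := sqrr_sign R[i] n.
move: (qpow q (n%:R * _)) (dqK _ _ _ _ x) (dqK _ _ _ _ x') => e k k'.
ring: s1.
Qed.

Lemma Wfun_neq0 (R : realType) (q s : R) N (x : 'I_N.+1) : 0 < q -> q != 1 ->
  Wfun N x s%:C q^-1 != 0.
Proof.
move=> q0 q1; rewrite WfunE // dqK_dual_weight_neq0 ?qpow_neq0 -1?ltnS //.
- by move=> i; apply: qpow2_exp_neq1.
- by move=> i; apply: qpow_base_1D_neq0.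
Qed.

(** * Dependence on u and v, and complex conjugation *)

Lemma kfun_shift (R : realType) (q : R) N (u s : R[i]) n x :
  kfun q N u s n x = qpow q (- (n%:R * u)) * kfun q N 0 s n x.
Proof.
rewrite /kfun !mulrA; congr (_ * _); rewrite [X in _ = X * _]mulrC -mulrA -qpowD.
congr (_ * qpow _ _); ring.
Qed.

Lemma rmorph_qpoch (K L : fieldType) (f : {rmorphism K -> L}) (a p : K) n :
  f (qpoch a p n) = qpoch (f a) (f p) n.
Proof.
rewrite rmorph_prod; apply: eq_bigr => i _.
by rewrite rmorphB rmorph1 rmorphM rmorphXn.
Qed.

Lemma rmorph_qpochs (K L : fieldType) (f : {rmorphism K -> L}) (s : seq K) p n :
  f (qpochs s p n) = qpochs (map f s) (f p) n.
Proof.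
rewrite /qpochs rmorph_prod big_map; apply: eq_bigr => a _; exact: rmorph_qpoch.
Qed.

Lemma kfun_conj (R : realType) (q s : R) N (u : R[i]) n x :
  (kfun q N u s%:C n x)^* = kfun q N u^* s%:C n x.
Proof.
rewrite /kfun !rmorphM rmorph_sign rmorph_sum /= qpow_conj.
congr (_ * qpow _ _ * _).
  by rewrite !(rmorph_nat, rmorphD, rmorphN, rmorphM, fmorphV) /= conj_realC.
apply: eq_bigr => j _; rewrite !rmorphM fmorphV !rmorph_qpochs /= rmorphN /= !qpow_conj.
by rewrite !(rmorph_nat, rmorphD, rmorphN, rmorphM) /= conj_realC.
Qed.

Lemma wfun_conj (R : realType) (q : R) N n : (wfun q N n)^* = wfun q N n.
Proof.
rewrite /wfun /qbinom !rmorphM fmorphV rmorphM !rmorph_qpoch /= !qpow_conj.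
by rewrite !(rmorph_nat, rmorphD, rmorphN, rmorphM).
Qed.

(** The parameters u = 1 and u = v merge into v + 1, which changes sign under v -> -v-2. *)
Lemma Rr_shift (R : realType) (q : R) N x y (s t v : R[i]) :
  Rr q N x y s t v = \sum_(n < N.+1) qpow q (- (n%:R * (v + 1)))
    * kfun q N 0 s n x * kfun q N 0 t n y * wfun q N n.
Proof.
apply: eq_bigr => n _; rewrite (kfun_shift q N 1) (kfun_shift q N v).
by rewrite mulrDr opprD qpowD; ring.
Qed.

Lemma Rr_conj (R : realType) (q s t : R) N x y (v : R[i]) :
  (Rr q N x y s%:C t%:C v)^* = Rr q N x y s%:C t%:C v^*.
Proof.
rewrite rmorph_sum; apply: eq_bigr => n _.
by rewrite 2!rmorphM /= !kfun_conj wfun_conj rmorph1.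
Qed.

(** * Orthogonality of R *)

Lemma Rr_sym (R : realType) (q : R) N x y (s t v : R[i]) :
  Rr q N x y s t v = Rr q N y x t s v.
Proof. by rewrite !Rr_shift; apply: eq_bigr => n _; ring. Qed.

Lemma Rr_orth (R : realType) (q s t : R) N (v : R[i]) (y y' : 'I_N.+1) :
    0 < q -> q != 1 ->
  \sum_(x < N.+1) Rr q N x y s%:C t%:C v
      * (Rr q N x y' s%:C t%:C (- v^* - 2))^* * Wfun N x s%:C q^-1
    = (y == y')%:R / Wfun N y t%:C q^-1.
Proof.
(* The right-hand side is read as the sum over n of w(n) k_{0,t}(n,y) k_{0,t}(n,y'). *)
move=> q0 q1; rewrite -kfun_orth //.
have dual := orth_transpose (fun x : 'I_N.+1 => Wfun_neq0 s x q0 q1)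
  (fun x x' => kfun_orth s x x' q0 q1).
rewrite -(orth_convolution (fun n y : 'I_N.+1 => kfun q N 0 t%:C n y)
  (e := fun n => qpow q (- (n%:R * (v + 1)))) (f := fun n => qpow q (n%:R * (v + 1)))
  dual); last by move=> n; rewrite -qpowD addNr qpow0.
apply: eq_bigr => x _; rewrite Rr_conj !Rr_shift.
congr (_ * _ * _); apply: eq_bigr => n _; congr (qpow _ _ * _ * _ * _).
by rewrite rmorphB rmorphN /= conjCK rmorph_nat; ring.
Qed.

Theorem proposition3p5 (R : realType) (q : R) (hq0 : 0 < q) (hq1 : q != 1)
    (N : nat) (s t : R) (v : R[i]) :
  (forall y y' : 'I_N.+1,
     \sum_(x < N.+1)
        Rr q N x y s%:C t%:C v * (Rr q N x y' s%:C t%:C (- v^* - 2))^*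
        * Wfun N x s%:C q^-1
     = (y == y')%:R / Wfun N y t%:C q^-1) /\
  (forall x x' : 'I_N.+1,
     \sum_(y < N.+1)
        Rr q N x y s%:C t%:C v * (Rr q N x' y s%:C t%:C (- v^* - 2))^*
        * Wfun N y t%:C q^-1
     = (x == x')%:R / Wfun N x s%:C q^-1).
Proof.
split=> [y y' | x x']; first exact: Rr_orth.
(* By symmetry the second relation is the first with s and t exchanged. *)
rewrite -(Rr_orth t s v) //.
by apply: eq_bigr => y _; rewrite (Rr_sym q N x) (Rr_sym q N x').
Qed.
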